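(* Let $\Omega_1$ be the partial functional on subsets $X\subseteq\mathbb N^{\mathbb N}$ which is defined exactly when $X=\{x\}$ for some $x$, with $\Omega_1(X)=x$. Let $\Psi$ be a total and countably based functional and let $\Xi$ be a total functional of type rank $\le 3$. Then the pairs $\Psi,\Omega_1$ and $\Psi,\Xi$ are not computationally equivalent.
   Context: Types: $0$ is a type of rank $0$; if $\sigma_1,\dots,\sigma_n$ ($n\ge 1$) are types, then $(\sigma_1,\dots,\sigma_n\to 0)$ is a type of rank $\max_i(\mathrm{rank}(\sigma_i)+1)$. Put $F(0)=\mathbb N$ and let $F(\sigma_1,\dots,\sigma_n\to 0)$ be the set of all total functions $F(\sigma_1)\times\cdots\times F(\sigma_n)\to\mathbb N$. Let $P(0)=\mathbb N\cup\{\bot\}$ and let $P(\sigma_1,\dots,\sigma_n\to 0)$ be the set of all functions $F(\sigma_1)\times\cdots\times F(\sigma_n)\to\mathbb N\cup\{\bot\}$, where $\bot$ means undefined (partial functionals, applied only to total arguments). A functional is total if it never takes the value $\bot$. Functionals with values in $\mathbb N^{\mathbb N}$ are viewed as $\mathbb N$-valued functionals with an extra number argument. Sets are given by characteristic functions. Computability: Kleene's S1–S9, where partial functionals of type rank $\le 3$ are allowed as oracles. That is, $\{e\}(\vec\phi)\simeq a$ is the least relation closed under Kleene's schemes: successor, constants, projection to a number argument, composition, primitive recursion, permutation of arguments, application of an argument, and S9: $\{e\}(m,\vec\phi,\vec\psi)\simeq\{m\}(\vec\phi)$. An application $\phi_i(\lambda\vec\xi_1.\{d_1\}(\vec\xi_1,\vec\phi),\dots,\lambda\vec\xi_k.\{d_k\}(\vec\xi_k,\vec\phi))$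 has value $a\in\mathbb N$ iff all the displayed functionals are total (on total arguments) and $\phi_i$ applied to them equals $a$. A partial functional $\psi$ is computable in $\vec\phi$ if for some $e$, $\{e\}(\vec\xi,\vec\phi)\simeq\psi(\vec\xi)$ for all total $\vec\xi$ with $\psi(\vec\xi)\ne\bot$. Two pairs are computationally equivalent if each member of either pair is computable in the other pair. Countably based (total case): let $\Phi\in F(\sigma)$ with $\mathrm{rank}(\sigma)\le 3$, $\sigma=(\tau_1,\dots,\tau_n\to 0)$, $\tau_i=(\delta_{i,1},\dots,\delta_{i,m_i}\to 0)$ with all $\delta_{i,j}$ of rank $\le 1$. $\Phi$ is countably based if for all $F_1,\dots,F_n$ there are countable sets $X_i\subseteq F(\delta_{i,1})\times\cdots\times F(\delta_{i,m_i})$ such that $\Phi(F_1,\dots,F_n)=\Phi(G_1,\dots,G_n)$ whenever $F_i$ and $G_i$ are equal on $X_i$ for each $i$. (So a countably based functional is by definition of type rank $\le 3$.) *)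

(* Defs.v *)
From mathcomp Require Import all_boot.
From mathcomp Require Import boolp classical_sets functions cardinality.

Set Implicit Arguments.
Unset Strict Implicit.
Unset Printing Implicit Defensive.

(* [Arr [:: s1; ..; sn]] is the type (s1, .., sn -> 0); the empty list encodes
   the base type 0, so that 0 needs no separate treatment below. *)
Inductive typ : Type := Arr of seq typ.

Definition typ0 : typ := Arr [::].

Definition dom (s : typ) : seq typ := let: Arr l := s in l.

Fixpoint rank (s : typ) : nat :=
  let: Arr l := s in foldr (fun t m => maxn (rank t).+1 m) 0 l.

Section Curried.
Variables (T : typ -> Type) (V : Type).

Fixpoint curried (l : seq typ) : Type :=
  if l is s :: l' then T s -> curried l' else V.

Fixpoint tuples (l : seq typ) : Type :=
  if l is s :: l' then (T s * tuples l')%type else unit.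

Fixpoint uncurry (l : seq typ) : curried l -> tuples l -> V :=
  if l is s :: l' then fun f x => uncurry (f x.1) x.2 else fun v _ => v.

End Curried.

(* Total functionals, curried: [F typ0] is [nat] and [F (Arr [:: s1; ..; sn])]
   is [F s1 -> .. -> F sn -> nat]. *)
Fixpoint F (s : typ) : Type := let: Arr l := s in curried F nat l.

(* Partial functionals on total arguments; [None] is "undefined". *)
Definition P (s : typ) : Type := curried F (option nat) (dom s).

Definition Fargs (l : seq typ) : Type := tuples F l.

Definition Fapp (s : typ) : F s -> Fargs (dom s) -> nat :=
  let: Arr l := s in fun f x => uncurry f x.

Definition Papp (s : typ) (f : P s) (x : Fargs (dom s)) : option nat :=
  uncurry f x.

Fixpoint curried_Some (l : seq typ) :
    curried F nat l -> curried F (option nat) l :=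
  if l is s :: l' then fun f x => curried_Some (f x) else fun v => Some v.

Definition of_total (s : typ) : F s -> P s :=
  let: Arr l := s in fun f => curried_Some f.

(* The i-th component (counted from 0); only meaningful for [i < size l]. *)
Fixpoint proj (l : seq typ) : Fargs l -> forall i, F (nth typ0 l i) :=
  match l return Fargs l -> forall i, F (nth typ0 l i) with
  | [::] => fun _ i => match i with 0 => 0 | _.+1 => 0 end
  | s :: l' => fun x i => match i with 0 => x.1 | i'.+1 => proj x.2 i' end
  end.

Definition arg : Type := {s : typ & P s}.

Definition Parg (s : typ) (f : P s) : arg := existT P s f.

Definition num (n : nat) : arg := @Parg typ0 (Some n).

Fixpoint pack (l : seq typ) : Fargs l -> seq arg :=
  match l return Fargs l -> seq arg with
  | [::] => fun _ => [::]
  | s :: l' => fun x => Parg (of_total x.1) :: pack x.2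
  end.

(* [kleene e phis a] is {e}(phi_0, .., phi_(n-1)) = a.  Indices are sequence
   numbers <scheme, parameters>, with [CodeSeq.code] coding finite sequences.
   Kleene's S7 and S8 are both instances of [S_app].  The length of the part of
   the argument list that S9 retains is a parameter of its index. *)
Inductive kleene : nat -> seq arg -> nat -> Prop :=
| S_succ x phis : kleene (CodeSeq.code [:: 1]) (num x :: phis) x.+1
| S_const q phis : kleene (CodeSeq.code [:: 2; q]) phis q
| S_proj x phis : kleene (CodeSeq.code [:: 3]) (num x :: phis) x
| S_comp e1 e2 phis b a :
    kleene e2 phis b -> kleene e1 (num b :: phis) a ->
    kleene (CodeSeq.code [:: 4; e1; e2]) phis a
| S_rec0 e0 e1 phis a :
    kleene e0 phis a ->
    kleene (CodeSeq.code [:: 5; e0; e1]) (num 0 :: phis) a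
| S_recS e0 e1 x phis b a :
    kleene (CodeSeq.code [:: 5; e0; e1]) (num x :: phis) b ->
    kleene e1 (num b :: num x :: phis) a ->
    kleene (CodeSeq.code [:: 5; e0; e1]) (num x.+1 :: phis) a
| S_perm d p phis a :
    perm_eq p (iota 0 (size phis)) ->
    kleene d [seq nth (num 0) phis i | i <- p] a ->
    kleene (CodeSeq.code [:: 6, d & p]) phis a
| S_app i ds phis s (phi : P s) (fs : Fargs (dom s)) a :
    onth phis i = Some (Parg phi) ->
    size ds = size (dom s) ->
    (forall j, j < size (dom s) ->
       forall xi : Fargs (dom (nth typ0 (dom s) j)),
         kleene (nth 0 ds j) (pack xi ++ phis) (Fapp (proj fs j) xi)) ->
    Papp phi fs = Some a ->
    kleene (CodeSeq.code [:: 8, i & ds]) phis a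
| S_index m phis psis a :
    kleene m phis a ->
    kleene (CodeSeq.code [:: 9; size phis]) (num m :: phis ++ psis) a.

Definition computable_in (s : typ) (psi : P s) (phis : seq arg) : Prop :=
  exists e, forall (xi : Fargs (dom s)) (a : nat),
    Papp psi xi = Some a -> kleene e (pack xi ++ phis) a.

Definition pairs_equivalent (s1 s2 t1 t2 : typ)
    (phi1 : P s1) (phi2 : P s2) (psi1 : P t1) (psi2 : P t2) : Prop :=
  [/\ computable_in phi1 [:: Parg psi1; Parg psi2],
      computable_in phi2 [:: Parg psi1; Parg psi2],
      computable_in psi1 [:: Parg phi1; Parg phi2] &
      computable_in psi2 [:: Parg phi1; Parg phi2]].

Definition countably_based (s : typ) (Phi : F s) : Prop :=
  rank s <= 3 /\
  forall fs : Fargs (dom s),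
    exists X : forall i, set (Fargs (dom (nth typ0 (dom s) i))),
      (forall i, i < size (dom s) -> countable (X i)) /\
      forall gs : Fargs (dom s),
        (forall i, i < size (dom s) ->
           forall x, X i x -> Fapp (proj fs i) x = Fapp (proj gs i) x) ->
        Fapp Phi fs = Fapp Phi gs.

Definition typ1 : typ := Arr [:: typ0].
Definition typ2 : typ := Arr [:: typ1].

(* Elements of [F typ2] that are not {0,1}-valued code no set. *)
Definition char_fun (A : set (nat -> nat)) : F typ2 :=
  fun f => nat_of_bool `[< A f >].

(* The value, an element of N^N, is given by the extra number argument. *)
Definition Omega1 : P (Arr [:: typ2; typ0]) := fun X n =>
  match pselect (exists x, X = char_fun [set x]%classic) with
  | left ex => Some (projT1 (cid ex) n)
  | right _ => None
  end.

Lemma Omega1P (X : F typ2) (n a : nat) :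
  Omega1 X n = Some a <->
  exists x, X = char_fun [set x]%classic /\ a = x n.
Proof.
rewrite /Omega1; case: pselect => [ex|nex]; last first.
  by split=> // -[x [Xx _]]; case: nex; exists x.
case: (cid ex) => y /= Xy; split=> [[<-]|[x [Xx ->]]]; first by exists y.
suff -> : y = x by [].
have := congr1 (fun h : F typ2 => h y) (etrans (esym Xy) Xx).
rewrite /char_fun /= (asboolT (erefl y : [set y]%classic y)).
by case: asboolP.
Qed.

(* Main.v *)
Require Import Defs.
From mathcomp Require Import all_boot.
From Stdlib Require Import Eqdep_dec.
From mathcomp Require Import boolp classical_sets cardinality.

(* Call a partial functional countably based if its value is determined, among
   the inputs on which it is defined, by countably many values of the input.
   Omega1 is countably based in this sense: on {x} it is enough to ask for the
   value at x.

   By induction on computations, if {e} converges at an input then it has the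
   same value at every input which agrees with the first one on a suitable
   countable set and at which {e} converges too.  Hence Xi, being total and
   computable in Psi and Omega1, is countably based, and it remains to see that
   Omega1 is not computable in two total countably based functionals.

   If {e} with such oracles diverges on the empty set, follow an infinite path
   of divergent subcomputations.  As the oracles are total, each step of the
   path is determined by values of convergent subcomputations, so by countably
   many values of the input; hence the same path occurs at all {x} with x outside
   a countable set, and {e} diverges there.  So for each n the value
   Omega1({x})(n) takes one and the same value v(n) for all x outside a countable
   set, and any such x other than v is a contradiction. *)

Set Implicit Arguments.
Unset Strict Implicit.
Unset Printing Implicit Defensive.

Local Open Scope classical_set_scope.

(** * Argument tuples, extensionality and rank *)

Lemma inj_Tagged (I : Type) (T : I -> Type) (i : I) (x y : T i) :
  existT T i x = existT T i y -> x = y.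
Proof. exact: (inj_pair2_eq_dec _ (fun u v => pselect (u = v))). Qed.

Lemma rank_dom s n j : rank s <= n.+1 -> j < size (dom s) ->
  rank (nth typ0 (dom s) j) <= n.
Proof.
case: s => l /=; elim: l j => //= s l IH [|j]; rewrite geq_max => /andP[hs hl].
  by [].
exact: IH.
Qed.

Lemma Papp_of_total s (f : F s) x : Papp (of_total f) x = Some (Fapp f x).
Proof. by case: s f x => l; rewrite /Papp /=; elim: l => //= s l IH f x. Qed.

Lemma Fapp_inj s (f g : F s) : Fapp f =1 Fapp g -> f = g.
Proof.
case: s f g => l /=; elim: l => [|s l IH] f g fg; first exact: (fg tt).
by apply: functional_extensionality_dep => u; apply: IH => x; exact: (fg (u, x)).
Qed.

Lemma Fapp_surj s (h : Fargs (dom s) -> nat) : exists f : F s, Fapp f =1 h.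
Proof.
case: s h => l /=; elim: l => [|s l IH] h; first by exists (h tt) => -[].
have [f fP] := choice (fun u => IH (fun x => h (u, x))).
by exists f => -[u x]; exact: fP.
Qed.

Lemma proj_inj l (fs gs : Fargs l) :
  (forall i, i < size l -> Fapp (proj fs i) =1 Fapp (proj gs i)) -> fs = gs.
Proof.
elim: l fs gs => [[] []//|s l IH] [f fs] [g gs] /= H.
congr pair; first exact: Fapp_inj (H 0 _).
by apply: IH => i il; exact: (H i.+1).
Qed.

Lemma proj_surj l (v : forall j, Fargs (dom (nth typ0 l j)) -> nat) :
  exists fs : Fargs l,
    forall j, j < size l -> Fapp (proj fs j) =1 v j.
Proof.
elim: l v => [|s l IH] v; first by exists tt.
have [fs fsP] := IH (fun j => v j.+1).
have [f fP] := Fapp_surj (v 0).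
by exists (f, fs) => -[|j] //= jl; exact: fsP.
Qed.

(** Rank at most 1 leaves only number arguments, so these are finite tuples of naturals. *)
Lemma countable_Fargs s : rank s <= 1 -> countable [set: Fargs (dom s)].
Proof.
case: s => l /=; elim: l => [|[[|? ?]] l IH] /= rl.
- exact: countableP.
- rewrite -setXTT; apply: countableX; first exact: countableP.
  by apply: IH; move: rl; rewrite geq_max => /andP[].
- by move: rl; rewrite geq_max ltnS geq_max ltn0.
Qed.

(** * Kleene's schemes: induction and inversion *)

(** Uncoded indices: as [encode] is injective, case analysis runs over schemes rather than sequence
    numbers. *)
Inductive scheme :=
| Succ | Const of nat | Proj | Comp of nat & nat | Rec of nat & nat
| Perm of nat & seq nat | App of nat & seq nat | Index of nat.

Definition encode (sc : scheme) : nat :=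
  CodeSeq.code match sc with
  | Succ => [:: 1]
  | Const q => [:: 2; q]
  | Proj => [:: 3]
  | Comp e1 e2 => [:: 4; e1; e2]
  | Rec e0 e1 => [:: 5; e0; e1]
  | Perm d p => [:: 6, d & p]
  | App i ds => [:: 8, i & ds]
  | Index n => [:: 9; n]
  end.

Lemma encode_inj : injective encode.
Proof.
by move=> sc sc' /(can_inj CodeSeq.codeK);
  case: sc => [|?||? ?|? ?|? ?|? ?|?]; case: sc' => [|?||? ?|? ?|? ?|? ?|?] //
  [] *; subst.
Qed.

(* One unfolding of [kleene], the recursive calls being answered by [R]. *)
Definition kstep (R : nat -> seq arg -> nat -> Prop) (sc : scheme)
    (phis : seq arg) (a : nat) : Prop :=
  match sc with
  | Succ => exists x psis, phis = num x :: psis /\ a = x.+1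
  | Const q => a = q
  | Proj => exists x psis, phis = num x :: psis /\ a = x
  | Comp e1 e2 => exists b, R e2 phis b /\ R e1 (num b :: phis) a
  | Rec e0 e1 => exists x psis, phis = num x :: psis /\
      match x with
      | 0 => R e0 psis a
      | y.+1 => exists b,
          R (encode (Rec e0 e1)) (num y :: psis) b /\
          R e1 [:: num b, num y & psis] a
      end
  | Perm d p => perm_eq p (iota 0 (size phis)) /\
      R d [seq nth (num 0) phis i | i <- p] a
  | App i ds => exists s (phi : P s) (fs : Fargs (dom s)),
      [/\ onth phis i = Some (Parg phi), size ds = size (dom s),
          (forall j, j < size (dom s) ->
             forall xi : Fargs (dom (nth typ0 (dom s) j)),
               R (nth 0 ds j) (pack xi ++ phis) (Fapp (proj fs j) xi)) &
          Papp phi fs = Some a]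
  | Index n => exists m psis, [/\ phis = num m :: psis, n <= size psis &
      R m (take n psis) a]
  end.

Lemma kstep_kleene sc phis a : kstep kleene sc phis a -> kleene (encode sc) phis a.
Proof.
case: sc => [|q||e1 e2|e0 e1|d p|i ds|n] /=.
- by move=> [x [psis [-> ->]]]; exact: S_succ.
- by move=> ->; exact: S_const.
- by move=> [x [psis [-> ->]]]; exact: S_proj.
- by move=> [b [H1 H2]]; exact: S_comp H1 H2.
- move=> [[|x] [psis [->]]]; first exact: S_rec0.
  by move=> [b [H1 H2]]; exact: S_recS H1 H2.
- by move=> [H1 H2]; exact: S_perm.
- by move=> [s [phi [fs [H1 H2 H3 H4]]]]; exact: S_app H1 H2 H3 H4.
- move=> [m [psis [-> H1 H2]]].
  by have := S_index (drop n psis) H2; rewrite cat_take_drop size_takel.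
Qed.

(** Each subcomputation carries its induction hypothesis as part of the relation given to
    [kstep]. *)
Lemma kleene_kstep_ind (Q : nat -> seq arg -> nat -> Prop) :
  (forall sc phis a,
     kstep (fun e phis a => kleene e phis a /\ Q e phis a) sc phis a ->
     Q (encode sc) phis a) ->
  forall e phis a, kleene e phis a -> Q e phis a.
Proof.
move=> H e phis a; elim=> {e phis a}.
- by move=> x phis; apply: (H Succ); exists x, phis.
- by move=> q phis; exact: (H (Const q)).
- by move=> x phis; apply: (H Proj); exists x, phis.
- by move=> e1 e2 phis b a *; apply: (H (Comp e1 e2)); exists b.
- by move=> e0 e1 phis a *; apply: (H (Rec e0 e1)); exists 0, phis.
- move=> e0 e1 x phis b a *; apply: (H (Rec e0 e1)).
  by exists x.+1, phis; split=> //; exists b.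
- by move=> d p phis a *; exact: (H (Perm d p)).
- move=> i ds phis s phi fs a H1 H2 H3 H4 H5; apply: (H (App i ds)).
  by exists s, phi, fs; split=> // j jl xi; split; [exact: H3|exact: H4].
- move=> m phis psis a H1 H2; apply: (H (Index (size phis))).
  exists m, (phis ++ psis); split=> //; first by rewrite size_cat leq_addr.
  by rewrite take_size_cat.
Qed.

Lemma kstep_sub (R R' : nat -> seq arg -> nat -> Prop) sc phis a :
  (forall e phis a, R e phis a -> R' e phis a) ->
  kstep R sc phis a -> kstep R' sc phis a.
Proof.
move=> RR'; case: sc => [|q||e1 e2|e0 e1|d p|i ds|n] //=.
- by move=> [b [? ?]]; exists b; split; exact: RR'.
- move=> [[|x] [psis [-> H]]]; [exists 0, psis|exists x.+1, psis]; split=> //.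
    exact: RR'.
  by move: H => [b [? ?]]; exists b; split; exact: RR'.
- by move=> [? ?]; split=> //; exact: RR'.
- move=> [s [phi [fs [? ? H ?]]]]; exists s, phi, fs; split=> // j jl xi.
  exact/RR'/H.
- by move=> [m [psis [? ? ?]]]; exists m, psis; split=> //; exact: RR'.
Qed.

Lemma kleene_kstep e phis a : kleene e phis a ->
  exists2 sc, e = encode sc & kstep kleene sc phis a.
Proof.
elim/kleene_kstep_ind => sc psis b H; exists sc => //.
by apply: kstep_sub H => ? ? ? [].
Qed.

Lemma kleeneE sc phis a : kleene (encode sc) phis a -> kstep kleene sc phis a.
Proof. by case/kleene_kstep => sc' /encode_inj ->. Qed.

(** * Sigma-filters and arguments depending on a parameter *)

Definition agree_on l (X : forall i, set (Fargs (dom (nth typ0 l i))))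
    (fs gs : Fargs l) : Prop :=
  forall i, i < size l -> forall x, X i x ->
    Fapp (proj fs i) x = Fapp (proj gs i) x.

Definition countables l (X : forall i, set (Fargs (dom (nth typ0 l i)))) :=
  forall i, i < size l -> countable (X i).

(** An empty [D] puts the whole space in [N], and a two-element one gives binary intersections. *)
Definition sigma_filter (K : Type) (N : set (set K)) : Prop :=
  (forall A B, A `<=` B -> N A -> N B) /\
  (forall (T : Type) (D : set T) (A : T -> set K), countable D ->
     (forall t, D t -> N (A t)) -> N [set k | forall t, D t -> A t k]).

Section Environments.
Variables (K : Type) (k0 : K) (N : set (set K)).
Hypothesis NF : sigma_filter N.

Let Nsub A B : A `<=` B -> N A -> N B.
Proof. exact: NF.1. Qed.

Let NT A : (forall k, A k) -> N A.
Proof.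
move=> HA; have := @NF.2 nat set0 (fun=> setT) (countable0 _).
by move=> /(_ (fun _ H => False_ind _ H)); apply: Nsub => k _; exact: HA.
Qed.

Let NI A B : N A -> N B -> N (A `&` B).
Proof.
move=> NA NB.
have H := @NF.2 bool setT (fun b => if b then A else B) (countableP _).
apply: Nsub (H _) => [k Hk|[]//].
by split; [exact: (Hk true)|exact: (Hk false)].
Qed.

(* An argument that varies with a parameter [k : K]; sets in [N] hold for almost
   all [k]. *)
Definition entry : Type := {s : typ & K -> P s}.

Definition arg_at (k : K) (en : entry) : arg := Parg (projT2 en k).

Definition args_at (k : K) : seq entry -> seq arg := map (arg_at k).

Definition const_entry (phi : arg) : entry :=
  existT (fun s => K -> P s) (projT1 phi) (fun _ => projT2 phi).

Lemma args_at_const k phis : args_at k (map const_entry phis) = phis.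
Proof. by elim: phis => //= -[s phi] phis ->. Qed.

(** Being countably based, comparing [k0] with almost all [k]: one [X] serves all these [k], and
    nothing is claimed where the functional is undefined. *)
Definition cb_entry (en : entry) : Prop :=
  rank (projT1 en) <= 3 /\
  forall fs a, Papp (projT2 en k0) fs = Some a ->
    exists2 X, @countables (dom (projT1 en)) X &
      N [set k | forall gs b, agree_on X fs gs ->
           Papp (projT2 en k) gs = Some b -> b = a].

Definition cb_env (env : seq entry) : bool := all (fun en => `[< cb_entry en >]) env.

Definition total_entry (en : entry) : Prop :=
  forall fs, Papp (projT2 en k0) fs <> None.

Definition total_env (env : seq entry) : bool :=
  all (fun en => `[< total_entry en >]) env.

Fixpoint entries l : (K -> Fargs l) -> seq entry :=
  match l return (K -> Fargs l) -> seq entry with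
  | [::] => fun _ => [::]
  | s :: l' => fun p =>
      existT (fun s => K -> P s) s (fun k => of_total (p k).1)
        :: entries (fun k => (p k).2)
  end.

Lemma args_at_entries l (p : K -> Fargs l) k : args_at k (entries p) = pack (p k).
Proof. by elim: l p => //= s l IH p; congr cons; exact: IH. Qed.

Lemma args_at_cat k env env' :
  args_at k (env ++ env') = args_at k env ++ args_at k env'.
Proof. exact: map_cat. Qed.

(** At rank at most 2 each argument has only countably many inputs, so [X] can be everything, and
    agreement is then equality. *)
Lemma cb_entry_total s (f : K -> F s) : rank s <= 2 ->
  (forall x, N [set k | Fapp (f k0) x = Fapp (f k) x]) ->
  cb_entry (existT (fun s => K -> P s) s (fun k => of_total (f k))).
Proof.
move=> rs fN; split=> /= [|fs a]; first exact: leq_trans rs _.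
rewrite Papp_of_total => -[<-]; exists (fun _ => setT).
  by move=> i il; apply: countable_Fargs; exact: rank_dom.
apply: Nsub (fN fs) => k /= -> gs b fsgs.
rewrite Papp_of_total => -[<-]; congr (Fapp _ _).
by apply/esym/proj_inj => i il x; exact: fsgs.
Qed.

Lemma cb_entries l (p : K -> Fargs l) :
  (forall i, i < size l -> rank (nth typ0 l i) <= 2) ->
  (forall i, i < size l -> forall x,
     N [set k | Fapp (proj (p k0) i) x = Fapp (proj (p k) i) x]) ->
  cb_env (entries p).
Proof.
elim: l p => //= s l IH p rl pN; apply/andP; split; last first.
  by apply: IH => [i|i] il; [exact: (rl i.+1)|exact: (pN i.+1)].
by apply/asboolP/cb_entry_total; [exact: (rl 0)|exact: (pN 0)].
Qed.

Lemma cb_entries_const l (xi : Fargs l) :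
  (forall i, i < size l -> rank (nth typ0 l i) <= 2) ->
  cb_env (entries (fun _ => xi)).
Proof. by move=> rl; apply: cb_entries => // i il x; exact: NT. Qed.

Lemma total_entries l (p : K -> Fargs l) : total_env (entries p).
Proof.
elim: l p => //= s l IH p; apply/andP; split; last exact: IH.
by apply/asboolP => fs /=; rewrite Papp_of_total.
Qed.

Lemma cb_num x : cb_entry (const_entry (num x)).
Proof. exact: (@cb_entry_total typ0 (fun _ => x) _ (fun _ => NT (fun _ => erefl))). Qed.

Lemma all_nth (a : pred entry) env d p : a d -> all a env ->
  all a [seq nth d env i | i <- p].
Proof.
move=> ad /all_nthP H; rewrite all_map; apply/allP => i _ /=.
by have [il|il] := ltnP i (size env); [exact: H|rewrite nth_default].
Qed.

Lemma all_onth (a : pred entry) env i en : all a env -> onth env i = Some en -> a en.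
Proof. by elim: env i => [|u env IH] [|i] //= /andP[au /IH H] => [[<-]//|/H]. Qed.

Lemma all_take_seq (a : pred entry) env n : all a env -> all a (take n env).
Proof. by rewrite -{1}(cat_take_drop n env) all_cat => /andP[]. Qed.

Lemma args_at_nth k env p :
  [seq nth (num 0) (args_at k env) i | i <- p] =
  args_at k [seq nth (const_entry (num 0)) env i | i <- p].
Proof.
rewrite /args_at -map_comp; apply: eq_map => i /=.
have [il|il] := ltnP i (size env); first by rewrite (nth_map (const_entry (num 0))).
by rewrite !nth_default ?size_map.
Qed.

(** The type of an entry does not depend on [k]: an entry that is a number at one [k] has type 0 at
    every [k]. *)
Lemma args_at_num k x env psis : args_at k env = num x :: psis ->
  exists (ph : K -> P typ0) env',
    [/\ env = existT (fun s => K -> P s) typ0 ph :: env', ph k = Some x &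
        psis = args_at k env'].
Proof.
case: env => [//|[s ph] env] H.
have /= E := congr1 (head (num 0)) H; have /= <- := congr1 behead H.
have Es : s = typ0 := congr1 (@projT1 _ _) E.
move: ph E {H}; rewrite Es => ph E; have phx := inj_Tagged E.
by exists ph, env; split.
Qed.

(** At type 0 the only argument tuple is [tt] and agreement is vacuous. *)
Lemma cb_num_head (ph : K -> P typ0) x :
  cb_entry (existT (fun s => K -> P s) typ0 ph) -> ph k0 = Some x ->
  N [set k | forall y, ph k = Some y -> y = x].
Proof.
move=> [_ /(_ tt x)] H /H [X _]; apply: Nsub => k /= Hk y.
exact: (Hk tt).
Qed.

Lemma cb_env_cons en env : cb_env (en :: env) -> cb_entry en /\ cb_env env.
Proof. by move=> /= /andP[/asboolP]. Qed.

Lemma cb_env_num x env : cb_env env -> cb_env (const_entry (num x) :: env).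
Proof. by move=> cbenv; apply/andP; split=> //; apply/asboolP/cb_num. Qed.

Lemma args_at_num_almost env x psis : cb_env env ->
  args_at k0 env = num x :: psis ->
  exists en env', [/\ env = en :: env', cb_env env', args_at k0 env' = psis &
    N [set k | forall y psis', args_at k env = num y :: psis' ->
         y = x /\ psis' = args_at k env']].
Proof.
move=> cbenv /args_at_num [ph [env' [Eenv phx ->]]]; subst env.
have [cb1 cb2] := cb_env_cons cbenv.
exists (existT (fun s => K -> P s) typ0 ph), env'; split=> //.
apply: Nsub (cb_num_head cb1 phx) => k Hk y psis'.
move=> /args_at_num [ph' [env'' [E phy ->]]].
have Eph := inj_Tagged (congr1 (head (const_entry (num 0))) E).
have /= <- := congr1 behead E; subst ph'.
by split=> //; exact: Hk.
Qed.

(** * Values of convergent computations *)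

(** Induction on the computation at [k0], for all environments at once, since subcomputations change
    the argument list. Application alone may call for infinite intersections. *)
Lemma kleene_almost_unique e env a : cb_env env -> kleene e (args_at k0 env) a ->
  N [set k | forall b, kleene e (args_at k env) b -> b = a].
Proof.
move=> cbenv H; move: H cbenv; move E0: (args_at k0 env) => phis H.
move: H env E0; elim/kleene_kstep_ind.
case=> [|q||e1 e2|e0 e1|d p|i ds|n] {e phis a} phis a /= H env Ephis cbenv.
- move: H => [x [psis [Ex ->]]]; rewrite {}Ex in Ephis.
  have [_ [env' [_ _ _ HN]]] := args_at_num_almost cbenv Ephis.
  by apply: Nsub HN => k Hk b /(@kleeneE Succ) [y [psis' [/Hk [-> _] ->]]].
- by rewrite H; apply: NT => k b /(@kleeneE (Const q)).
- move: H => [x [psis [Ex ->]]]; rewrite {}Ex in Ephis.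
  have [_ [env' [_ _ _ HN]]] := args_at_num_almost cbenv Ephis.
  by apply: Nsub HN => k Hk b /(@kleeneE Proj) [y [psis' [/Hk [-> _] ->]]].
- move: H => [b [[_ H2] [_ H1]]].
  have {}H2 := H2 _ Ephis cbenv.
  have {}H1 := H1 (const_entry (num b) :: env) (congr1 (cons _) Ephis) (cb_env_num _ cbenv).
  apply: Nsub (NI H1 H2) => k [K1 K2] c /(@kleeneE (Comp e1 e2)) [b' [/K2 -> H]].
  exact: K1.
- move: H => [x [psis [Ex H]]]; rewrite {}Ex in Ephis.
  have [_ [env' [_ cbenv' Epsis HN]]] := args_at_num_almost cbenv Ephis.
  case: x Ephis H HN => [|x] Ephis H HN.
    apply: Nsub (NI HN (H.2 _ Epsis cbenv')) => k [Hk Hk2] b.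
    move=> /(@kleeneE (Rec e0 e1)) [y [psis' [/Hk [-> ->]]]].
    exact: Hk2.
  move: H => [c [[_ H1] [_ H2]]].
  have {}H1 := H1 (const_entry (num x) :: env') (congr1 (cons _) Epsis) (cb_env_num _ cbenv').
  have {}H2 := H2 [:: const_entry (num c), const_entry (num x) & env']
    (congr1 (fun s => [:: num c, num x & s]) Epsis)
    (cb_env_num _ (cb_env_num _ cbenv')).
  apply: Nsub (NI HN (NI H1 H2)) => k [Hk [K1 K2]] b.
  move=> /(@kleeneE (Rec e0 e1)) [y [psis' [/Hk [-> ->]]]] [b' [/K1 ->]].
  exact: K2.
- move: H => [_ [_ H]].
  have /H {}H : args_at k0 [seq nth (const_entry (num 0)) env i | i <- p] =
    [seq nth (num 0) phis i | i <- p] by rewrite -args_at_nth Ephis.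
  have /H {}H : cb_env [seq nth (const_entry (num 0)) env i | i <- p].
    by apply: all_nth => //; apply/asboolP/cb_num.
  apply: Nsub H => k Hk b /(@kleeneE (Perm d p)) [_].
  by rewrite args_at_nth; exact: Hk.
- move: H => [s [phi [fs [Ei sds H phia]]]].
  move: Ei; rewrite -Ephis onth_map.
  case Ei: (onth env i) => [[s' ph]|] //= /Some_inj E.
  have Es : s' = s := congr1 (@projT1 _ _) E.
  move: ph Ei E; rewrite Es => ph Ei E; have /= E3 := inj_Tagged E.
  have /asboolP [/= rs cbph] := all_onth cbenv Ei.
  have [X cX NX] : exists2 X, @countables (dom s) X &
      N [set k | forall gs b, agree_on X fs gs -> Papp (ph k) gs = Some b -> b = a].
    by apply: (cbph fs a); rewrite /= E3.
  (* Countably many positions and points of [X] are involved, so almost every [k] can only yield the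
     values of [fs] on [X]. *)
  have HN : N [set k | forall j, j < size (dom s) -> forall xi, X j xi ->
      forall b, kleene (nth 0 ds j) (pack xi ++ args_at k env) b ->
        b = Fapp (proj fs j) xi].
    apply: (NF.2 _ [set j | j < size (dom s)]) => [|j jl]; first exact: countableP.
    apply: NF.2 => [|xi Xxi]; first exact: cX.
    have [_ Hj] := H j jl xi.
    have := Hj (entries (fun _ => xi) ++ env).
    rewrite args_at_cat args_at_entries Ephis => /(_ erefl).
    rewrite /cb_env all_cat andbC (cbenv : all _ env = true) /=.
    have -> : all (fun en => `[< cb_entry en >]) (entries (fun _ : K => xi)).
      apply: cb_entries_const => l ll; apply: rank_dom => //; apply: leqW.
      exact: rank_dom.
    move=> /(_ isT); apply: Nsub => k Hk b Hb.
    by apply: Hk; rewrite args_at_cat args_at_entries.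
  apply: Nsub (NI NX HN) => k [Hk1 Hk2] b.
  move=> /(@kleeneE (App i ds)) [s2 [phi2 [gs [Ei2 _ Hgs phib]]]].
  move: Ei2; rewrite onth_map Ei /= => /Some_inj E2.
  have Es2 : s = s2 := congr1 (@projT1 _ _) E2.
  move: phi2 gs phib Hgs E2; rewrite -Es2 => phi2 gs phib Hgs E2.
  have {}E2 := inj_Tagged E2; subst phi2.
  (* The functionals [gs] computed at [k] may differ from [fs], but not on [X], which is all that
     [NX] asks. *)
  apply: Hk1 phib => j jl xi Xxi; apply/esym.
  by apply: Hk2 => //; exact: Hgs.
- move: H => [m [psis [Em ns H]]]; rewrite {}Em in Ephis.
  have [_ [env' [_ cbenv' Epsis HN]]] := args_at_num_almost cbenv Ephis.
  have := H.2 (take n env').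
  rewrite /args_at map_take -/(args_at _ _) Epsis => /(_ erefl (all_take_seq n cbenv')).
  move=> H1; apply: Nsub (NI HN H1) => k [Hk1 Hk2] b.
  move=> /(@kleeneE (Index n)) [y [psis' [/Hk1 [-> ->] _]]].
  by rewrite /args_at -map_take; exact: Hk2.
Qed.

(** * Divergent computations *)

Lemma total_num_head env k y psis : total_env env ->
  args_at k env = num y :: psis ->
  exists x psis', args_at k0 env = num x :: psis'.
Proof.
move=> totenv /args_at_num [ph [env' [Eenv _ _]]]; subst env.
have /andP[/asboolP /(_ tt) + _] := totenv.
rewrite /Papp /= /arg_at /=; case: (ph k0) => // x _.
by exists x, (args_at k0 env').
Qed.

(** A number in front at some [k] has type 0 everywhere, so totality gives it a value at [k0], the
    only possible one at almost every [k]. *)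
Lemma divergent_num_head env k y psis : cb_env env -> total_env env ->
  args_at k env = num y :: psis ->
  exists x env', [/\ cb_env env', total_env env',
    args_at k0 env = num x :: args_at k0 env' &
    N [set k | forall y psis', args_at k env = num y :: psis' ->
         y = x /\ psis' = args_at k env']].
Proof.
move=> cbenv totenv /(total_num_head totenv) [x [psis' Ex]].
have [en [env' [Een cbenv' Epsis HN]]] := args_at_num_almost cbenv Ex.
exists x, env'; split=> //; last by rewrite Epsis.
by move: totenv; rewrite Een => /andP[].
Qed.

(* [R] ranges over subrelations of [kleene] to say that [e'] is an immediate
   subcomputation of [e], in a form that fits [kleene_kstep_ind]. *)
Lemma divergent_step e env : cb_env env -> total_env env ->
  (forall a, ~ kleene e (args_at k0 env) a) ->
  exists e' env', [/\ cb_env env', total_env env',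
    forall a, ~ kleene e' (args_at k0 env') a &
    N [set k | forall (R : nat -> seq arg -> nat -> Prop) sc a,
      (forall e phis a, R e phis a -> kleene e phis a) ->
      e = encode sc -> kstep R sc (args_at k env) a ->
      exists a', R e' (args_at k env') a']].
Proof.
move=> cbenv totenv dive.
have [[sc Esc]|nsc] := pselect (exists sc, e = encode sc); last first.
  exists e, env; split=> //; apply: NT => k R sc a _ Esc.
  by case: nsc; exists sc.
subst e.
(* If no [k] allows a first step, any divergent computation can serve as the
   next one. *)
have [[k [a Hka]]|stuck] :=
  pselect (exists k a, kstep kleene sc (args_at k env) a); last first.
  exists (encode sc), env; split=> //; apply: NT => k R sc' a RK /encode_inj <- H.
  by case: stuck; exists k, a; apply: kstep_sub H.
have {}dive a' : ~ kstep kleene sc (args_at k0 env) a'.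
  by move=> /kstep_kleene; exact: dive.
suff [e' [env' [? ? ? HN]]] : exists e' env', [/\ cb_env env', total_env env',
    forall a, ~ kleene e' (args_at k0 env') a &
    N [set k | forall (R : nat -> seq arg -> nat -> Prop) a,
      (forall e phis a, R e phis a -> kleene e phis a) ->
      kstep R sc (args_at k env) a ->
      exists a', R e' (args_at k env') a']].
  exists e', env'; split=> //; apply: Nsub HN => k' Hk R sc' b RK /encode_inj <-.
  exact: Hk.
case: sc dive Hka => [|q||e1 e2|e0 e1|d p|i ds|n] dive /=.
- move=> [x [psis [/(total_num_head totenv) [y [psis' E]] _]]].
  by case: (dive y.+1); exists y, psis'.
- by case: (dive q).
- move=> [x [psis [/(total_num_head totenv) [y [psis' E]] _]]].
  by case: (dive y); exists y, psis'.
(* If [e2] diverges at [k0], the path goes there. Otherwise its value [b] is the only possible one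
   at almost every [k], and the path goes to [e1] with that [b]. *)
- move=> _; have [[b Hb]|div2] := pselect (exists b, kleene e2 (args_at k0 env) b); last first.
    exists e2, env; split=> //; first by move=> b Hb; apply: div2; exists b.
    by apply: NT => k' R c _ [b [Hb _]]; exists b.
  exists e1, (const_entry (num b) :: env); split=> //.
  + exact: cb_env_num.
  + by apply/andP; split=> //; apply/asboolP.
  + by move=> c Hc; apply: (dive c); exists b.
  apply: Nsub (kleene_almost_unique cbenv Hb) => k' Hk R c RK [b' [/RK/Hk -> H]].
  by exists c.
- move=> [x [psis [/(divergent_num_head cbenv totenv) [y [env' [cb' tot' E HN]]] _]]].
  case: y E HN => [|y] E HN.
    exists e0, env'; split=> //.
      by move=> c Hc; apply: (dive c); exists 0, (args_at k0 env').
    by apply: Nsub HN => k' Hk R c RK [y [psis' [/Hk [-> ->]]]]; exists c.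
  have cby : cb_env (const_entry (num y) :: env') by exact: cb_env_num.
  have toty : total_env (const_entry (num y) :: env').
    by apply/andP; split=> //; apply/asboolP.
  have [[b Hb]|div2] := pselect (exists b,
      kleene (encode (Rec e0 e1)) (args_at k0 (const_entry (num y) :: env')) b); last first.
    exists (encode (Rec e0 e1)), (const_entry (num y) :: env'); split=> //.
      by move=> b Hb; apply: div2; exists b.
    apply: Nsub HN => k' Hk R c RK [y' [psis' [/Hk [-> ->]]]] [b [Hb _]].
    by exists b.
  exists e1, [:: const_entry (num b), const_entry (num y) & env']; split=> //.
  + exact: cb_env_num.
  + by apply/andP; split=> //; apply/asboolP.
  + move=> c Hc; apply: (dive c); exists y.+1, (args_at k0 env'); split=> //.
    by exists b.
  apply: Nsub (NI HN (kleene_almost_unique cby Hb)) => k' [Hk1 Hk2] R c RK.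
  move=> [y' [psis' [/Hk1 [-> ->]]]] [b' [/RK/Hk2 -> H]].
  by exists c.
- move=> [pp _]; exists d, [seq nth (const_entry (num 0)) env i | i <- p]; split.
  + by apply: all_nth => //; apply/asboolP/cb_num.
  + by apply: all_nth => //; apply/asboolP.
  + move=> c Hc; apply: (dive c); split; first by move: pp; rewrite !size_map.
    by rewrite args_at_nth.
  by apply: NT => k' R c _ [_]; rewrite args_at_nth => H; exists c.
- move=> [s [phi [_ [Ei sds _ _]]]].
  move: Ei; rewrite onth_map.
  case Ei: (onth env i) => [[s' ph]|] //= /Some_inj E.
  have Es : s' = s := congr1 (@projT1 _ _) E.
  move: ph Ei {E}; rewrite Es => ph Ei.
  have /asboolP [/= rs _] := all_onth cbenv Ei.
  have /asboolP totph := all_onth totenv Ei.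
  (* A point [xi] where an argument functional diverges continues the path: at every [k],
     application requires convergence at [xi]. *)
  have [[j [jl [xi divj]]]|convj] := pselect (exists j, j < size (dom s) /\
      exists xi : Fargs (dom (nth typ0 (dom s) j)),
      forall b, ~ kleene (nth 0 ds j) (pack xi ++ args_at k0 env) b).
    exists (nth 0 ds j), (entries (fun _ => xi) ++ env); split.
    + rewrite /cb_env all_cat andbC (cbenv : all _ env = true) /=.
      apply: cb_entries_const => l ll; apply: rank_dom => //; apply: leqW.
      exact: rank_dom.
    + rewrite /total_env all_cat andbC (totenv : all _ env = true) /=.
      exact: total_entries.
    + by move=> b; rewrite args_at_cat args_at_entries; exact: divj.
    apply: NT => k' R c _ [s2 [phi2 [gs [Ei2 _ Hgs phib]]]].
    move: Ei2; rewrite onth_map Ei /= => /Some_inj E2.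
    have Es2 : s2 = s := esym (congr1 (@projT1 _ _) E2).
    move: phi2 gs phib Hgs E2; rewrite Es2 => phi2 gs phib Hgs E2.
    exists (Fapp (proj gs j) xi); rewrite args_at_cat args_at_entries.
    exact: Hgs.
  (* Otherwise all argument functionals are total at [k0], and totality of the oracle contradicts
     divergence. The default 0 concerns only positions beyond the arity. *)
  have [v vP] : exists v : forall j, Fargs (dom (nth typ0 (dom s) j)) -> nat,
      forall j, j < size (dom s) -> forall xi,
      kleene (nth 0 ds j) (pack xi ++ args_at k0 env) (v j xi).
    have H j (xi : Fargs (dom (nth typ0 (dom s) j))) : exists b, j < size (dom s) ->
        kleene (nth 0 ds j) (pack xi ++ args_at k0 env) b.
      have [jl|jl] := pselect (j < size (dom s)); last by exists 0.
      apply: contrapT => H; apply: convj; exists j; split=> //; exists xi => b Hb.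
      by apply: H; exists b.
    exists (fun j xi => projT1 (cid (H j xi))) => j jl xi.
    by case: (cid _) => b /=; exact.
  have [fs fsP] := proj_surj v.
  case Ea: (Papp (ph k0) fs) => [c|]; last by case: (totph fs).
  case: (dive c); exists s, (ph k0), fs; split=> //.
    by rewrite onth_map Ei.
  by move=> j jl xi; rewrite fsP //; exact: vP.
- move=> [m [psis [Em ns _]]].
  have [y [env' [cb' tot' E HN]]] := divergent_num_head cbenv totenv Em.
  (* The number of arguments is the same at every [k], so the length condition carries over to
     [k0]. *)
  have sizes k' : size (args_at k' env) = (size env').+1.
    by have := congr1 size E; rewrite /args_at /= !size_map.
  exists y, (take n env'); split; try exact: all_take_seq.
  + move=> c Hc; apply: (dive c); exists y, (args_at k0 env'); split=> //.
      by have := sizes k; rewrite Em /= => -[Es]; rewrite size_map -Es.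
    by rewrite /args_at -map_take.
  apply: Nsub HN => k' Hk R c _ [y' [psis' [/Hk [-> ->] _]]].
  by rewrite /args_at -map_take => H; exists c.
Qed.

(** The countably many steps of the path hold at once for almost every [k]; a computation at such a
    [k] would descend along it forever, against its well-foundedness. *)
Lemma kleene_almost_divergent e env : cb_env env -> total_env env ->
  (forall a, ~ kleene e (args_at k0 env) a) ->
  N [set k | forall a, ~ kleene e (args_at k env) a].
Proof.
move=> cbenv totenv dive.
pose ok (st : nat * seq entry) := [/\ cb_env st.2, total_env st.2 &
  forall a, ~ kleene st.1 (args_at k0 st.2) a].
pose down (st st' : nat * seq entry) := [set k |
  forall (R : nat -> seq arg -> nat -> Prop) sc a,
      (forall e phis a, R e phis a -> kleene e phis a) ->
      st.1 = encode sc -> kstep R sc (args_at k st.2) a ->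
      exists a', R st'.1 (args_at k st'.2) a'].
(* States that are not [ok] stay put, so that [choice] gives a function on all states. *)
have next st : exists st', ok st -> ok st' /\ N (down st st').
  have [[cb1 tot1 div1]|nok] := pselect (ok st); last by exists st.
  have [e' [env' [? ? ? ?]]] := divergent_step cb1 tot1 div1.
  by exists (e', env').
have [f fP] := choice next.
pose st i := iter i f (e, env).
have okst i : ok (st i) by elim: i => [//|i IH]; exact: (fP _ IH).1.
have HN : N [set k | forall i, [set: nat] i -> down (st i) (st i.+1) k].
  by apply: NF.2 => [|i _]; [exact: countableP|exact: (fP _ (okst i)).2].
apply: Nsub HN => k Hk a.
suff nost e' phis b : kleene e' phis b -> forall i,
    e' = (st i).1 -> phis = args_at k (st i).2 -> False.
  by move=> H; exact: (nost _ _ _ H 0).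
elim/kleene_kstep_ind => {e' phis} {}b sc phis H i Esc Ephis.
rewrite Ephis in H.
have [c [_ Q]] := Hk i I _ _ _ (fun _ _ _ => @proj1 _ _) (esym Esc) H.
exact: (Q i.+1).
Qed.

End Environments.

(** * Countably based partial functionals *)

(** Here the parameter is the argument tuple itself, with [fs] as [k0]. *)
Definition near_args l (fs : Fargs l) : set (set (Fargs l)) :=
  [set A | exists2 X, @countables l X & forall gs, agree_on X fs gs -> A gs].

Lemma near_args_sigma_filter l (fs : Fargs l) : sigma_filter (near_args fs).
Proof.
split=> [A B AB [X cX XA]|T D A cD NA].
  by exists X => // gs /XA /AB.
have H t : exists X, D t -> countables X /\ forall gs, agree_on X fs gs -> A t gs.
  have [Dt|nDt] := pselect (D t); last by exists (fun=> set0).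
  by have [X cX XA] := NA t Dt; exists X.
have [X XP] := choice H.
exists (fun i => \bigcup_(t in D) X t i).
  by move=> i il; apply: bigcup_countable => // t Dt; exact: (XP t Dt).1.
move=> gs fsgs t Dt; apply: (XP t Dt).2 => i il x Xx.
by apply: fsgs => //; exists t.
Qed.

Lemma near_args_eval l (fs : Fargs l) i (x : Fargs (dom (nth typ0 l i))) :
  i < size l ->
  near_args fs [set gs | Fapp (proj fs i) x = Fapp (proj gs i) x].
Proof.
move=> il; pose T j := Fargs (dom (nth typ0 l j)).
exists (fun j => [set y | existT T j y = existT T i x]).
  move=> j _; apply/countable_injP; exists (fun=> 0) => y z.
  by rewrite !inE /= => Ey Ez _; exact: inj_Tagged (etrans Ey (esym Ez)).
by move=> gs; exact.
Qed.

(** Only inputs at which the functional is defined are compared. This lets [Omega1] qualify,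
    although no countable set of values reveals whether a set is a singleton. *)
Definition countably_based_partial s (phi : P s) : Prop :=
  rank s <= 3 /\
  forall fs a, Papp phi fs = Some a ->
    exists2 X, @countables (dom s) X &
      forall gs b, agree_on X fs gs -> Papp phi gs = Some b -> b = a.

Lemma countably_based_of_total s (Phi : F s) :
  countably_based Phi -> countably_based_partial (of_total Phi).
Proof.
move=> [rs cb]; split=> // fs a; rewrite Papp_of_total => -[<-].
have [X [cX H]] := cb fs; exists X => // gs b /H ->.
by rewrite Papp_of_total => -[].
Qed.

Lemma countably_based_Omega1 : countably_based_partial (Omega1 : P (Arr [:: typ2; typ0])).
Proof.
split=> // -[X [n []]] a; rewrite /Papp /= => /Omega1P [x [-> ->]].
exists (fun i => match i return set (Fargs (dom (nth typ0 [:: typ2; typ0] i))) with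
  | 0 => [set (x, tt)]
  | _.+1 => setT
  end).
  move=> [|[|i]] // _; exact: countableP.
move=> [Y [m []]] b /= agr; rewrite /Papp /= => /Omega1P [y [Yy ->]].
have /= <- := agr 1 isT tt I.
have := agr 0 isT (x, tt) erefl; rewrite /= Yy /char_fun.
rewrite (asboolT (erefl x : [set x] x)); case: asboolP => // -> _.
by [].
Qed.

Lemma cb_env_const K (k0 : K) N s1 s2 (phi1 : P s1) (phi2 : P s2) : sigma_filter N ->
  countably_based_partial phi1 -> countably_based_partial phi2 ->
  cb_env k0 N (map (const_entry K) [:: Parg phi1; Parg phi2]).
Proof.
move=> NF cb1 cb2.
have H s (phi : P s) : countably_based_partial phi ->
    cb_entry k0 N (const_entry K (Parg phi)).
  move=> [rs cb]; split=> // fs a /cb [X cX XP]; exists X => //.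
  have := NF.2 nat set0 (fun=> setT) (countable0 _).
  by move=> /(_ (fun _ H => False_ind _ H)); apply: NF.1.
by apply/and3P; split=> //; apply/asboolP; exact: H.
Qed.

Lemma cb_env_near l (fs : Fargs l) s1 s2 (phi1 : P s1) (phi2 : P s2) :
  (forall i, i < size l -> rank (nth typ0 l i) <= 2) ->
  countably_based_partial phi1 -> countably_based_partial phi2 ->
  cb_env fs (near_args fs)
    (entries id ++ map (const_entry (Fargs l)) [:: Parg phi1; Parg phi2]).
Proof.
move=> rl cb1 cb2; rewrite /cb_env all_cat; apply/andP; split.
  apply: cb_entries => //; first exact: near_args_sigma_filter.
  by move=> i il x; exact: near_args_eval.
by apply: cb_env_const => //; exact: near_args_sigma_filter.
Qed.

Lemma args_at_near l (fs : Fargs l) phis :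
  args_at fs (entries id ++ map (const_entry (Fargs l)) phis) = pack fs ++ phis.
Proof. by rewrite args_at_cat args_at_entries args_at_const. Qed.

Lemma countably_based_computable t (Xi : F t) s1 s2 (phi1 : P s1) (phi2 : P s2) :
  rank t <= 3 -> countably_based_partial phi1 -> countably_based_partial phi2 ->
  computable_in (of_total Xi) [:: Parg phi1; Parg phi2] ->
  countably_based_partial (of_total Xi).
Proof.
move=> rt cb1 cb2 [e He]; split=> // fs a Ha.
have rl i : i < size (dom t) -> rank (nth typ0 (dom t) i) <= 2 by exact: rank_dom.
have := He _ _ Ha; rewrite -args_at_near => Hk.
have [X cX XP] := kleene_almost_unique (near_args_sigma_filter fs)
  (cb_env_near fs rl cb1 cb2) Hk.
exists X => // gs b /XP + /He; rewrite -args_at_near.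
exact.
Qed.

(** * [Omega1] against total countably based oracles *)

(** Cantor's diagonal: with [g] injecting [C] into the numbers, [x] exceeds each [y] in [C] by one
    at place [g y]. *)
Lemma exists_notin_countable (C : set (nat -> nat)) : countable C -> exists x, ~ C x.
Proof.
move=> /countable_injP [g ginj].
pose x n := if pselect (exists2 y, C y & g y = n) is left ex
            then (projT1 (cid2 ex) n).+1 else 0.
exists x => Cx.
have : x (g x) = x (g x) by [].
rewrite {1}/x; case: pselect => [ex|[]]; last by exists x.
case: (cid2 ex) => y /= Cy gy.
have -> : y = x by apply: ginj; rewrite ?inE.
by move/eqP; rewrite -[X in _ == X]addn0 -addn1 eqn_add2l.
Qed.

Lemma Omega1_not_computable s t (Psi : F s) (Xi : F t) :
  countably_based_partial (of_total Psi) -> countably_based_partial (of_total Xi) ->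
  ~ computable_in (Omega1 : P (Arr [:: typ2; typ0]))
      [:: Parg (of_total Psi); Parg (of_total Xi)].
Proof.
move=> cb1 cb2 [e He].
pose l := [:: typ2; typ0].
pose pt A n : Fargs l := (char_fun A, (n, tt)).
pose phis := [:: Parg (of_total Psi); Parg (of_total Xi)].
pose env := entries id ++ map (const_entry (Fargs l)) phis.
have rl i : i < size l -> rank (nth typ0 l i) <= 2 by case: i => [|[|i]].
(* The base point is the empty set, where [Omega1] is undefined, so [e] may converge or diverge
   there. *)
have detn n : exists v, near_args (pt set0 n)
    [set k | forall b, kleene e (args_at k env) b -> b = v].
  have cbenv := cb_env_near (pt set0 n) rl cb1 cb2.
  have [[a Ha]|div] := pselect (exists a, kleene e (args_at (pt set0 n) env) a).
    by exists a; apply: kleene_almost_unique Ha; first exact: near_args_sigma_filter.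
  have totenv : total_env (pt set0 n) env.
    rewrite /total_env all_cat; apply/andP; split; first exact: (@total_entries _ (pt set0 n) l id).
    by apply/and3P; split=> //; apply/asboolP => fs; rewrite /= Papp_of_total.
  (* The value 0 is arbitrary, since [e] diverges at almost every [k]. *)
  exists 0; have := kleene_almost_divergent (near_args_sigma_filter (pt set0 n))
    cbenv totenv (fun a Ha => div (ex_intro _ a Ha)).
  by apply: (near_args_sigma_filter _).1 => k Hk b /Hk.
have detC n : exists vC : nat * set (nat -> nat), countable vC.2 /\
    forall x, ~ vC.2 x -> forall b,
      kleene e (args_at (pt [set x] n) env) b -> b = vC.1.
  have [v [X cX XP]] := detn n.
  (* [{x}] and the empty set differ only at [x], so they agree on [X] once [x] is outside its first
     component. *)
  exists (v, [set x | X 0 (x, tt)]); split=> /= [|x nXx].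
    have /countable_injP [g ginj] := cX 0 isT.
    apply/countable_injP; exists (fun x => g (x, tt)) => x y.
    rewrite !inE /= => Xx Xy Eg.
    have : (x, tt) = (y, tt) by apply: ginj; rewrite ?inE.
    by case.
  apply: XP => -[|[|i]] //= _ [y []] Xy; rewrite /char_fun.
  by rewrite !asboolF // => yx; apply: nXx; rewrite -yx.
have [vC vCP] := choice detC.
pose v n := (vC n).1.
(* Index 0 adds the candidate [v] itself to the exceptional sets, which are shifted to the indices
   [m.+1]. *)
have [x xP] : exists x, ~ (\bigcup_(n in setT)
    (if n is m.+1 then (vC m).2 else [set v])) x.
  apply: exists_notin_countable; apply: bigcup_countable => [|[|m] _].
  - exact: countableP.
  - exact: countable1.
  - exact: (vCP m).1.
(* It remains to see [x = v]: outside the exceptional sets [e] can only return [v n] on [{x}] and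
   [n], while it computes [x n]. *)
apply: (xP); exists 0 => //=; apply/functional_extensionality_dep => n.
apply: ((vCP n).2 x) => [Cx|]; first by apply: xP; exists n.+1.
rewrite args_at_near; apply: (He (pt [set x] n)).
by rewrite /Papp /=; apply/Omega1P; exists x.
Qed.

Theorem corollary3p30 (s t : typ) (Psi : F s) (Xi : F t) :
  countably_based Psi -> rank t <= 3 ->
  ~ pairs_equivalent (of_total Psi) Omega1 (of_total Psi) (of_total Xi).
Proof.
move=> /countably_based_of_total cbPsi rt [_ Omega1c _ Xic].
apply: Omega1_not_computable Omega1c => //.
exact: countably_based_computable rt cbPsi countably_based_Omega1 Xic.
Qed.
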